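(* Let $n\ge2$. The sequences $0\to I_n^{1',1}\hookrightarrow\Sigma(D_n)\xrightarrow{\gamma}\Sigma(B_{n-2})\to0$ and $0\to\mathring{\mathcal{P}}_n\hookrightarrow\mathcal{P}_n\xrightarrow{\pi}\mathcal{P}_{n-2}\to0$ are exact, the maps $\psi:I_n^{1',1}\to\mathring{\mathcal{P}}_n$, $\psi:\Sigma(D_n)\to\mathcal{P}_n$ and $\varphi:\Sigma(B_{n-2})\to\mathcal{P}_{n-2}$ are well defined and surjective, and the resulting diagram commutes, i.e. $\pi\circ\psi=\varphi\circ\gamma$ on $\Sigma(D_n)$.
   Context: $B_m$: signed permutations $w=w_1\dots w_m$ of $[m]$, values ordered $\cdots<-2<-1<1<2<\cdots$, $w_0=0$, $\mathrm{Des}(w)=\{i\in\{0,\dots,m-1\}:w_i>w_{i+1}\}$; $X_J=\sum_{\mathrm{Des}(w)\subseteq J}w$; $\Sigma(B_m)=\mathrm{span}\{X_J\}$. $D_n\subseteq B_n$: signed permutations with an even number of negative entries; the descent set of $w\in D_n$ is the subset of $\{1',1,\dots,n-1\}$ where $1'$ is a descent iff $-w_1>w_2$ and $i\in[n-1]$ is a descent iff $w_i>w_{i+1}$; $X_J=\sum_{\mathrm{Des}(w)\subseteq J}w$ for $J\subseteq\{1',1,\dots,n-1\}$ and $\Sigma(D_n)=\mathrm{span}\{X_J\}$. $\gamma:\Sigma(D_n)\to\Sigma(B_{n-2})$ is the linear map $X_J\mapsto X_{J-2}$ if $1,1'\notin J$ (so $J\subseteq\{2,\dots,n-1\}$ and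 $J-2\subseteq\{0,\dots,n-3\}$), $X_J\mapsto0$ otherwise. $I_n^{1',1}=\mathrm{span}\{X_J: 1'\in J\text{ or }1\in J\}\subseteq\Sigma(D_n)$. $\varphi$ forgets signs ($w\mapsto|w_1|\dots|w_m|$, linearly), $\psi$ is its restriction to $\mathbb{Q}D_n$. For $u\in\mathfrak{S}_m$: $\mathrm{Peak}(u)=\{i\in[m-1]:u_{i-1}<u_i>u_{i+1}\}$ with $u_0=0$, $\mathring{\mathrm{Peak}}(u)=\mathrm{Peak}(u)\setminus\{1\}$; $\mathcal{F}_m$: subsets of $[m-1]$ with no two consecutive integers, $\mathring{\mathcal{F}}_m=\{F\in\mathcal{F}_m:1\notin F\}$; $P_F=\sum_{\mathrm{Peak}(u)=F}u$, $\mathring{P}_F=\sum_{\mathring{\mathrm{Peak}}(u)=F}u$; $\mathcal{P}_m=\mathrm{span}\{P_F\}$, $\mathring{\mathcal{P}}_n=\mathrm{span}\{\mathring{P}_F\}$, $\mathcal{P}_0=\mathcal{P}_1=\mathbb{Q}$. $\pi:\mathcal{P}_n\to\mathcal{P}_{n-2}$: $P_F\mapsto P_{F-2}$ if $1,2\notin F$; $P_F\mapsto-P_{(F\setminus\{1\})-2}$ if $1\in F$; $P_F\mapsto0$ if $2\in F$. *)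

(* Defs.v *)
From HB Require Import structures.
From mathcomp Require Import all_boot all_order all_fingroup all_algebra.
Set Implicit Arguments. Unset Strict Implicit. Unset Printing Implicit Defensive.
Import Order.TTheory GRing.Theory Num.Theory.
Local Open Scope ring_scope.

(* ---------- Conventions ----------
   Positions: a set of positions of a word of length m is a {set 'I_m};
   the ordinal i stands for the paper's integer i (so 'I_m = {0,...,m-1}).
   For D_n the index set {1',1,...,n-1} is encoded by 'I_n with 0 <-> 1'
   and i <-> i for 1 <= i <= n-1. *)

(* Signed permutations of [m]: underlying permutation p and sign vector s;
   the entry at position i (1-based) is  (-1)^{s(i-1)} * (p(i-1)+1). *)
Definition SP (m : nat) := ({perm 'I_m} * {ffun 'I_m -> bool})%type.

Definition wv m (w : SP m) (i : nat) : int :=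
  nth 0 (0 :: [seq (if w.2 k then -1 else 1) * ((w.1 k).+1)%:Z | k <- enum 'I_m]) i.

Definition DesB m (w : SP m) : {set 'I_m} :=
  [set i : 'I_m | wv w i.+1 < wv w i].

Definition inD n (w : SP n) : bool := ~~ odd #|[set k | w.2 k]|.

(* descent set in D_n, encoded in 'I_n (0 = 1') *)
Definition DesD n (w : SP n) : {set 'I_n} :=
  [set i : 'I_n | if val i == 0%N then wv w 2 < - wv w 1 else wv w i.+1 < wv w i].

(* group algebras: Q-valued functions on the group (formal linear combinations) *)
Notation QB m := {ffun SP m -> rat}.
Notation QS m := {ffun {perm 'I_m} -> rat}.

Definition scl (T : finType) (k : rat) (f : {ffun T -> rat}) : {ffun T -> rat} :=
  [ffun x => k * f x].

Definition XB m (J : {set 'I_m}) : QB m :=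
  [ffun w => if DesB w \subset J then 1 else 0].
Definition XD n (J : {set 'I_n}) : QB n :=
  [ffun w => if inD w && (DesD w \subset J) then 1 else 0].

Definition inSigmaB m (v : QB m) : Prop :=
  exists c : {ffun {set 'I_m} -> rat}, v = \sum_J scl (c J) (XB J).
Definition XDC n (c : {ffun {set 'I_n} -> rat}) : QB n := \sum_J scl (c J) (XD J).
Definition inSigmaD n (v : QB n) : Prop :=
  exists c : {ffun {set 'I_n} -> rat}, v = XDC c.

Definition hasv m (J : {set 'I_m}) (k : nat) : bool := [exists i in J, val i == k].

Definition inI n (v : QB n) : Prop :=
  exists c : {ffun {set 'I_n} -> rat},
    v = \sum_(J | hasv J 0 || hasv J 1) scl (c J) (XD J).

Definition shift2 n (J : {set 'I_n}) : {set 'I_(n - 2)} :=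
  [set j : 'I_(n - 2) | hasv J (val j).+2].

(* gamma, on the linear combination  sum_J c_J X_J *)
Definition gammaC n (c : {ffun {set 'I_n} -> rat}) : QB (n - 2) :=
  \sum_J scl (c J) (if hasv J 0 || hasv J 1 then 0 else XB (shift2 J)).

Definition phi m (v : QB m) : QS m := [ffun u => \sum_(w : SP m | w.1 == u) v w].

Definition uv m (u : {perm 'I_m}) (i : nat) : nat :=
  nth 0%N (0%N :: [seq (u k).+1 | k <- enum 'I_m]) i.

Definition Peak m (u : {perm 'I_m}) : {set 'I_m} :=
  [set i : 'I_m | (0 < val i)%N && (uv u i.-1 < uv u i)%N && (uv u i.+1 < uv u i)%N].
Definition PeakO m (u : {perm 'I_m}) : {set 'I_m} :=
  [set i in Peak u | val i != 1%N].

Definition isF m (F : {set 'I_m}) : bool :=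
  ~~ hasv F 0 && [forall i in F, forall j in F, val j != (val i).+1].
Definition isFO m (F : {set 'I_m}) : bool := isF F && ~~ hasv F 1.

Definition PP m (F : {set 'I_m}) : QS m := [ffun u => if Peak u == F then 1 else 0].
Definition PO m (F : {set 'I_m}) : QS m := [ffun u => if PeakO u == F then 1 else 0].

Definition PC m (d : {ffun {set 'I_m} -> rat}) : QS m := \sum_(F | isF F) scl (d F) (PP F).
Definition inP m (x : QS m) : Prop := exists d, x = PC d.
Definition inPO m (x : QS m) : Prop :=
  exists d : {ffun {set 'I_m} -> rat}, x = \sum_(F | isFO F) scl (d F) (PO F).

(* pi, on the linear combination  sum_{F in F_n} d_F P_F *)
Definition piimg n (F : {set 'I_n}) : QS (n - 2) :=
  if hasv F 1 then - PP (shift2 [set i in F | val i != 1%N])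
  else if hasv F 2 then 0 else PP (shift2 F).
Definition piC n (d : {ffun {set 'I_n} -> rat}) : QS (n - 2) :=
  \sum_(F | isF F) scl (d F) (piimg F).

(* Main.v *)
(* Write |w| = u. Whether an edge i is a descent of w is decided by the sign
   of the entry of larger absolute value among w_i and w_{i+1}, so Des(w) ⊆ J
   prescribes some signs and leaves the others free. Two prescriptions clash
   exactly at peaks i of u with i-1, i ∉ J, and therefore φ(X_J) = 2^|J| Σ P_F
   over F ⊆ J ∪ (J+1). In type D the edges 1' and 1 are both decided by the
   larger of |w_1|, |w_2|: if 1' or 1 lies in J, position 1 being a peak of u
   does not matter and half of the free signs are even, so ψ(X_J) is 2^(|J|-1)
   times a sum of P°_F; if neither does, they clash when 1 is a peak and
   coincide otherwise, so ψ(X_J) is 2^|J| times a sum of P_F with 1 ∉ F.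
   Commutativity follows from these two formulas.

   For surjectivity take J = F - 1: each G without consecutive elements inside
   F ∪ (F-1) has a smaller sum of elements than F unless G = F, so the system
   is triangular. *)
Require Import Defs.
From HB Require Import structures.
From mathcomp Require Import all_boot all_order all_fingroup all_algebra.
From mathcomp Require Import zify.
Import Order.TTheory GRing.Theory Num.Theory.
Set Implicit Arguments. Unset Strict Implicit. Unset Printing Implicit Defensive.
Local Open Scope ring_scope.

Arguments hasv : simpl never.

Lemma hasvP m (J : {set 'I_m}) k :
  reflect (exists2 i : 'I_m, i \in J & i = k :> nat) (hasv J k).
Proof.
apply: (iffP existsP) => [[i /andP[iJ /eqP <-]]|[i iJ <-]]; exists i => //.
by rewrite iJ /=.
Qed.

Lemma hasv_val m (J : {set 'I_m}) (i : 'I_m) : hasv J i = (i \in J).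
Proof.
apply/hasvP/idP => [[j jJ /ord_inj <-]//|iJ]; by exists i.
Qed.

(** * Sign vectors with prescribed entries, and the even ones among them *)

Section Counting.
Variable T : finType.
Implicit Types (C : {set T}) (t : T -> bool) (s : {ffun T -> bool}).

Lemma card_forced C t :
  #|[set s : {ffun T -> bool} | [forall k in C, s k == t k]]| = (2 ^ #|~: C|)%N.
Proof.
pose D k := if k \in C then pred1 (t k) else predT.
rewrite (_ : [set _ | _] = [set s in family D]); last first.
  apply/setP => s; rewrite !in_set; apply/forall_inP/familyP => h k.
    by rewrite /D; case: ifP => // kC; rewrite inE h.
  by move=> kC; have := h k; rewrite /D kC inE.
rewrite cardsE card_family foldrE big_map big_enum /=.
rewrite (eq_bigr (fun k => if k \in ~: C then 2 else 1)%N); last first.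
  move=> k _; rewrite /D inE; case: (k \in C) => /=; first by rewrite card1.
  by rewrite -card_bool; apply: eq_card.
by rewrite -big_mkcond /= prod_nat_const.
Qed.

(** Flipping the sign at a position [k0] outside [C] is a parity-reversing involution of the
    solutions, so exactly half of them are even. *)
Lemma card_forced_even C t : C != setT ->
  (2 * #|[set s : {ffun T -> bool} | [forall k in C, s k == t k]
             & ~~ odd #|[set k | s k]|]|)%N = (2 ^ #|~: C|)%N.
Proof.
rewrite -subTset => /subsetPn[k0 _ k0C].
rewrite -(card_forced C t).
set A := [set s : {ffun T -> bool} | [forall k in C, s k == t k]].
pose E := [set s : {ffun T -> bool} | ~~ odd #|[set k | s k]|].
pose flip s : {ffun T -> bool} := [ffun k => (k == k0) (+) s k].
have flipK : involutive flip.
  by move=> s; apply/ffunP => k; rewrite !ffunE addbA addbb.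
have flipA s : (flip s \in A) = (s \in A).
  rewrite !inE; apply: eq_forallb => k; rewrite ffunE.
  by case: (eqVneq k k0) => [->|//]; rewrite (negPf k0C).
have flipE s : (flip s \in E) = (s \notin E).
  rewrite !inE negbK (cardsD1 k0) [in RHS](cardsD1 k0) !oddD !inE ffunE eqxx /=.
  rewrite (_ : [set k | flip s k] :\ k0 = [set k | s k] :\ k0); last first.
    by apply/setP => k; rewrite !inE ffunE; case: (k == k0).
  by rewrite !oddb; case: (s k0); case: (odd _).
have -> : [set s : {ffun T -> bool} | [forall k in C, s k == t k]
             & ~~ odd #|[set k | s k]|] = A :&: E.
  by apply/setP => s; rewrite !inE.
rewrite -(cardsID E A) mul2n -addnn; congr addn.
rewrite -(card_imset _ (inv_inj flipK)); apply: eq_card => s.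
rewrite -[s in LHS]flipK (mem_imset _ _ (inv_inj flipK)) !in_setI flipA flipE.
by rewrite in_setD andbC.
Qed.

End Counting.

(** * Descents of signed words and peaks of permutations *)

Section Words.
Variable m : nat.
Implicit Types (u : {perm 'I_m}) (s : {ffun 'I_m -> bool}) (F G J : {set 'I_m}).

Lemma uvS u (k : 'I_m) : uv u k.+1 = (u k).+1.
Proof. by rewrite /uv /= (nth_map k) ?size_enum_ord // nth_ord_enum. Qed.

Lemma wvS (w : SP m) (k : 'I_m) :
  wv w k.+1 = (if w.2 k then -1 else 1) * ((w.1 k).+1)%:Z.
Proof. by rewrite /wv /= (nth_map k) ?size_enum_ord // nth_ord_enum. Qed.

Definition desc u (i : nat) := (uv u i.+1 < uv u i)%N.

Definition ord_prev (i : 'I_m) : 'I_m :=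
  Ordinal (leq_ltn_trans (leq_pred i) (ltn_ord i)).

(* 0-based position carrying the larger of the absolute values |w_i| and |w_{i+1}| *)
Definition top u (i : 'I_m) : 'I_m := if desc u i then ord_prev i else i.

Lemma desc0 u : desc u 0 = false.
Proof. by rewrite /desc ltn0. Qed.

(** If |w_i| is the larger, edge i is an ascent iff w_i is negative; if |w_{i+1}| is, iff w_{i+1} is
    positive. So the required sign bit is [desc u i]. Edge 0, with w_0 = 0, is of the second
    kind. *)
Lemma notin_DesB u s (i : 'I_m) :
  (i \notin DesB ((u, s) : SP m)) = (s (top u i) == desc u i).
Proof.
rewrite inE /top /desc wvS uvS /=.
case: i => [[|j] ltj] /=.
  rewrite ltn0 /= /wv /=; case: (s _); lia.
have ltj' : (j < m)%N by apply: ltnW.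
pose j' := Ordinal ltj'.
have -> : uv u j.+1 = (u j').+1 by rewrite -(uvS u j').
have -> : wv (u, s) j.+1 = (if s j' then -1 else 1) * ((u j').+1)%:Z
  by rewrite -(wvS (u, s) j').
set i := Ordinal ltj.
have ne : (u i : nat) <> u j'.
  by move/ord_inj/perm_inj/(congr1 val) => /=; lia.
have -> : ord_prev i = j' by apply/val_inj.
move: ne; case: ltnP => h ne /=.
  by case: (s i); case: (s j'); lia.
by case: (s i); case: (s j'); lia.
Qed.

Lemma ascE u (i : 'I_m) : (0 < i)%N -> (uv u i.-1 < uv u i)%N = ~~ desc u i.-1.
Proof.
case: i => [[//|[|j]] ltj] _ /=.
  by have := uvS u (Ordinal (ltnW ltj)); rewrite /desc /= => ->.
have h1 := uvS u (Ordinal (ltnW ltj)).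
have h2 := uvS u (Ordinal (ltnW (ltnW ltj))).
rewrite /desc; move: h1 h2 => /= -> ->.
have ne : (u (Ordinal (ltnW ltj)) : nat) <> u (Ordinal (ltnW (ltnW ltj))).
  by move/ord_inj/perm_inj/(congr1 val) => /=; lia.
move: ne => /=; lia.
Qed.

Lemma mem_Peak u (i : 'I_m) : (i \in Peak u) = ~~ desc u i.-1 && desc u i.
Proof.
rewrite inE; case: (posnP i) => [i0|i0] /=; last by rewrite ascE.
by rewrite i0 desc0.
Qed.

Lemma isF_Peak u : isF (Peak u).
Proof.
apply/andP; split.
  by apply/hasvP => -[i]; rewrite mem_Peak => /andP[_ h] i0; rewrite i0 desc0 in h.
apply/forall_inP => i; rewrite mem_Peak => /andP[_ di].
apply/forall_inP => j; rewrite mem_Peak => /andP[dj _].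
by apply: contraNN dj => /eqP ->.
Qed.

Lemma isFP F :
  reflect ((forall i : 'I_m, i \in F -> (0 < i)%N) /\
           (forall i j : 'I_m, i \in F -> j \in F -> j <> i.+1 :> nat)) (isF F).
Proof.
apply: (iffP andP) => -[h1 h2]; split.
- move=> i iF; rewrite lt0n; apply: contraNN h1 => /eqP i0; apply/hasvP.
  by exists i.
- by move=> i j iF jF; have /forall_inP/(_ j jF)/eqP := forall_inP h2 i iF.
- by apply/hasvP => -[i /h1] + i0; rewrite i0.
- apply/forall_inP => i iF; apply/forall_inP => j jF; apply/eqP; exact: h2.
Qed.

(* The involution exchanging the values i and i+1 for every i in F has F as
   both its descent set and its peak set. *)
Lemma Peak_surj F : isF F -> exists u, Peak u = F.
Proof.
case/isFP => F0 FF.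
have Fn k : hasv F k -> hasv F k.+1 = false.
  case/hasvP => i iF <-; apply/hasvP => -[j jF jE]; exact: FF jE.
have Flt k : hasv F k -> (0 < k < m)%N.
  by case/hasvP => i iF <-; rewrite F0 //=.
pose sw k := if hasv F k.+1 then k.+1 else if hasv F k then k.-1 else k.
have sw_lt (k : 'I_m) : (sw k < m)%N.
  rewrite /sw; case: ifP => [/Flt/andP[]//|_].
  case: ifP => // _; exact: leq_ltn_trans (leq_pred _) _.
have swK k : sw (sw k) = k.
  rewrite /sw; case: (boolP (hasv F k.+1)) => [h|h].
    by rewrite Fn // h.
  case: (boolP (hasv F k)) => [h'|h']; last by rewrite (negPf h) (negPf h').
  by have /andP[k0 _] := Flt _ h'; rewrite prednK // h'.
pose f (k : 'I_m) := Ordinal (sw_lt k).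
have fK : involutive f by move=> k; apply/val_inj; rewrite /= swK.
exists (perm (inv_inj fK)); apply/setP => i.
have dE (j : 'I_m) : desc (perm (inv_inj fK)) j = (j \in F).
  rewrite /desc uvS permE /= -hasv_val.
  case: j => [[|j] ltj] /=.
    by rewrite ltn0; apply/esym/negbTE/negP => /Flt.
  have -> := uvS (perm (inv_inj fK)) (Ordinal (ltnW ltj)).
  rewrite permE /= /sw.
  case: (boolP (hasv F j.+2)) => h2; case: (boolP (hasv F j.+1)) => h1;
    case: (boolP (hasv F j)) => h0 //=; try (by rewrite Fn in h1); try lia.
  - by rewrite Fn in h2.
rewrite mem_Peak dE -[desc _ i.-1]/(desc _ (ord_prev i)) dE.
case: (boolP (i \in F)) => iF; rewrite ?andbF // andbT.
apply/negP => h; apply: (FF _ _ h iF) => /=; by rewrite prednK // F0.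
Qed.

End Words.
Arguments desc : simpl never.

(** * Systems of sign prescriptions *)

Section Solutions.
Variables (I T : finType) (J : {set I}) (top : I -> T) (b : I -> bool).

(** Common form of Des(w) ⊆ J for types B and D: an edge i outside [J] prescribes the bit [b i] at
    position [top i], and consistency excludes clashes. *)
Definition consistent : Prop :=
  forall i i', i \notin J -> i' \notin J -> top i = top i' -> b i = b i'.

Definition solves (s : {ffun T -> bool}) := [forall i in ~: J, s (top i) == b i].

Lemma solves_consistent s : solves s -> consistent.
Proof.
move=> /forall_inP sol i i' iJ i'J e.
have /eqP <- := sol i ltac:(by rewrite inE).
by have /eqP <- := sol i' ltac:(by rewrite inE); rewrite e.
Qed.

(** The bit demanded at k is that of any prescribing edge over k; by consistency all of them agree,
    and the existential evaluates to their common bit. *)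
Lemma solves_forced s : consistent ->
  solves s = [forall k in top @: (~: J),
                s k == [exists i in ~: J, (top i == k) && b i]].
Proof.
move=> con; have tE i : i \in ~: J ->
    [exists i' in ~: J, (top i' == top i) && b i'] = b i.
  rewrite inE => iJ; apply/exists_inP/idP => [[i']|bi].
    by rewrite inE => i'J /andP[/eqP e bi']; rewrite (con i i').
  by exists i; rewrite ?inE ?iJ // eqxx.
apply/forall_inP/forall_inP => [sol _ /imsetP[i iJ ->]|sol i iJ].
  by rewrite tE // sol.
by rewrite -tE // sol // imset_f.
Qed.

Lemma card_solves : consistent ->
  #|[set s | solves s]| = (2 ^ #|~: (top @: (~: J))|)%N.
Proof.
move=> con; rewrite -(card_forced (top @: (~: J))
  (fun k => [exists i in ~: J, (top i == k) && b i])).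
by apply: eq_card => s; rewrite !inE solves_forced.
Qed.

Lemma card_solves_even : consistent -> top @: (~: J) != setT ->
  (2 * #|[set s | solves s & ~~ odd #|[set k | s k]|]|)%N
  = (2 ^ #|~: (top @: (~: J))|)%N.
Proof.
move=> con nT; rewrite -(card_forced_even
  (fun k => [exists i in ~: J, (top i == k) && b i]) nT); congr muln.
by apply: eq_card => s; rewrite !inE solves_forced.
Qed.

End Solutions.

Lemma sum_same_perm m (u : {perm 'I_m}) (f : SP m -> rat) :
  \sum_(w : SP m | w.1 == u) f w = \sum_(s : {ffun 'I_m -> bool}) f (u, s).
Proof.
rewrite (reindex_onto (fun s => (u, s) : SP m) (fun w => w.2)) /=.
  by apply: eq_bigl => s; rewrite !eqxx.
by move=> [u' s] /= /eqP ->.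
Qed.

Lemma sum_indicator (T : finType) (P : pred T) :
  \sum_(s : T) (if P s then 1 else 0 : rat) = #|[set s | P s]|%:R.
Proof.
rewrite -big_mkcond /= -sum1_card natr_sum.
by apply: eq_bigl => s; rewrite inE.
Qed.

(** * Type B: the coefficients of φ(X_J) *)

Section TypeB.
Variable m : nat.
Implicit Types (u : {perm 'I_m}) (s : {ffun 'I_m -> bool}) (F G J K : {set 'I_m}).

(** The condition F ⊆ K ∪ (K+1); [nB K F] will be the coefficient in φ(X_K) of any u with peak set
    F. *)
Definition compatB K F := [forall i in F, (i \in K) || hasv K i.-1].
Definition nB K F : rat := if compatB K F then 2 ^+ #|K| else 0.

Lemma DesB_sub u s J :
  (DesB ((u, s) : SP m) \subset J) = solves J (top u) (desc u) s.
Proof.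
apply/subsetP/forall_inP => [sub i|sol i].
  by rewrite inE => iJ; rewrite -notin_DesB; apply: contra iJ => /sub.
by apply: contraTT => iJ; rewrite notin_DesB sol // inE.
Qed.

Lemma top_inj u (i i' : 'I_m) : top u i = top u i' -> desc u i = desc u i' -> i = i'.
Proof.
rewrite /top => + e; rewrite -e; case: ifP => // d /(congr1 val) /= e'.
have pos (j : 'I_m) : desc u j -> (0 < j)%N by case: (val j) => //; rewrite desc0.
have := pos _ d; have := pos i'; rewrite -e d => /(_ isT) h h'.
by apply/ord_inj; lia.
Qed.

(** Distinct edges share a top only if they are i-1, an ascent of u, and i, a descent of u. This is
    a peak at i, and the two bits then differ. *)
Lemma consistentB u J : consistent J (top u) (desc u) <-> compatB J (Peak u).
Proof.
split=> [con|/forall_inP com].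
  apply/forall_inP => i; rewrite mem_Peak => /andP[d' d].
  case: (boolP (i \in J)) => //= iJ; apply: contraT => h.
  have := con i (ord_prev i) iJ; rewrite -hasv_val => /(_ h).
  by rewrite /top /= d (negPf d') => /(_ erefl).
suff con i i' : i \notin J -> i' \notin J -> top u i = top u i' ->
    desc u i -> desc u i'.
  by move=> i i' iJ i'J e; apply/idP/idP; apply: con.
move=> iJ i'J e d; apply: contraT => d'; move: e; rewrite /top d (negPf d') => e.
have /com : i \in Peak u by rewrite mem_Peak d andbT -[i.-1]/(val (ord_prev i)) e.
by rewrite (negPf iJ) /= -[i.-1]/(val (ord_prev i)) hasv_val e (negPf i'J).
Qed.

Lemma phi_XB J u : phi (XB J) u = nB J (Peak u).
Proof.
rewrite ffunE sum_same_perm.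
under eq_bigr do rewrite ffunE DesB_sub.
rewrite sum_indicator /nB; case: ifP => [/consistentB con|ncon].
  rewrite card_solves // natrX; congr (_ ^+ _).
  (* By consistency and [top_inj], [top u] is injective off [J], which leaves |J| positions free. *)
  apply/eqP; rewrite -(eqn_add2l #|top u @: (~: J)|) cardsC.
  rewrite card_in_imset; first by rewrite addnC cardsC.
  move=> i i'; rewrite !inE => iJ i'J e; apply: (top_inj e); exact: con.
rewrite (_ : [set s | _] = set0) ?cards0 //; apply/setP => s; rewrite !inE.
by apply/negP => /solves_consistent/consistentB; rewrite ncon.
Qed.

End TypeB.

(** * Spans, inversion over supersets, triangular systems *)

Section LinearAlgebra.

Lemma sum_sclE (S I : finType) (P : pred I) (c : I -> rat) (X : I -> {ffun S -> rat}) x :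
  (\sum_(i | P i) scl (c i) (X i)) x = \sum_(i | P i) c i * X i x.
Proof. by rewrite sum_ffunE; apply: eq_bigr => i _; rewrite ffunE. Qed.

Lemma reindex_span (S I T : finType) (P : pred I) (Q : pred T) (f : I -> T)
    (X : T -> {ffun S -> rat}) (c : I -> rat) :
  (forall i, P i -> Q (f i)) ->
  exists c' : {ffun T -> rat},
    \sum_(i | P i) scl (c i) (X (f i)) = \sum_(j | Q j) scl (c' j) (X j).
Proof.
move=> PQ; exists [ffun j => \sum_(i | P i && (f i == j)) c i].
apply/ffunP => x; rewrite !sum_sclE (partition_big f Q) //=.
apply: eq_bigr => j _; rewrite ffunE mulr_suml.
by apply: eq_bigr => i /andP[_ /eqP ->].
Qed.

Lemma restrict_span (S T : finType) (Q : pred T) (X : T -> {ffun S -> rat})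
    (c : {ffun T -> rat}) :
  \sum_(j | Q j) scl (c j) (X j)
  = \sum_j scl ([ffun j => if Q j then c j else 0] j) (X j).
Proof.
apply/ffunP => x; rewrite !sum_sclE big_mkcond; apply: eq_bigr => j _.
by rewrite ffunE; case: (Q j); rewrite ?mul0r.
Qed.

(** Downward induction on inclusion: once [c] and [c'] agree on the proper supersets of K, the two
    sums can differ only in the term at K. This yields the linear independence of the X_J. *)
Lemma superset_sum_inj (T : finType) (c c' : {ffun {set T} -> rat}) :
  (forall K : {set T}, \sum_(J : {set T} | K \subset J) c J = \sum_(J : {set T} | K \subset J) c' J) ->
  c = c'.
Proof.
move=> eqs; apply/ffunP => K; have [k] := ubnP #|~: K|.
elim: k K => // k IH K; rewrite ltnS => leK.
have := eqs K; rewrite (bigD1 K) //= [in RHS](bigD1 K) //=.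
rewrite (eq_bigr c') => [/addIr //|J /andP[KJ JK]].
apply: IH; apply: leq_trans leK; apply: proper_card.
by rewrite properC properEneq eq_sym JK.
Qed.

Lemma triangular_solve (T : finType) (wt : T -> nat) (M : T -> T -> rat) :
  (forall F, M F F != 0) ->
  (forall F G, M F G != 0 -> F = G \/ (wt G < wt F)%N) ->
  forall g : T -> rat, exists c : T -> rat, forall G, \sum_F c F * M F G = g G.
Proof.
move=> Mdiag Mtri.
(* Induction on a bound for the weights where [g] is nonzero; beyond the largest weight the
   assumption is vacuous. *)
suff main k : forall g, (forall G, (k <= wt G)%N -> g G = 0) ->
    exists c : T -> rat, forall G, \sum_F c F * M F G = g G.
  move=> g; apply: (main (\max_G wt G).+1) => G; rewrite ltnNge.
  by rewrite leq_bigmax.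
elim: k => [|k IH] g g0.
  by exists (fun=> 0) => G; rewrite g0 // big1 // => F _; rewrite mul0r.
(* [c1] cancels [g] in weight k. A row of weight k vanishes at all other columns of weight at least
   k, so the remainder is zero from weight k on. *)
pose c1 F := if wt F == k then g F / M F F else 0.
have [G kG|c2 c2E] := IH (fun G => g G - \sum_F c1 F * M F G).
  rewrite (bigD1 G) //= big1 => [|F FG]; last first.
    rewrite /c1; case: eqP => [wF|]; last by rewrite mul0r.
    have [->|/Mtri[e|]] := eqVneq (M F G) 0; first by rewrite mulr0.
      by rewrite e eqxx in FG.
    by rewrite wF ltnNge kG.
  rewrite addr0 /c1; case: eqP => [_|/eqP ne]; first by rewrite mulfVK ?subrr.
  by rewrite mul0r subr0 g0 // ltn_neqAle eq_sym ne.
exists (fun F => c1 F + c2 F) => G.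
under eq_bigr do rewrite mulrDl.
by rewrite big_split /= c2E addrC subrK.
Qed.

End LinearAlgebra.

(** * Peak spaces, and the surjectivity of φ in type B *)

Section PeakSpan.
Variable m : nat.
Implicit Types (u : {perm 'I_m}) (F G J K : {set 'I_m}) (x : QS m).

Lemma PCE (d : {ffun {set 'I_m} -> rat}) u : PC d u = d (Peak u).
Proof.
rewrite sum_sclE (bigD1 (Peak u)) ?isF_Peak //= ffunE eqxx mulr1.
rewrite big1 ?addr0 // => F /andP[_ /negPf ne].
by rewrite ffunE eq_sym ne mulr0.
Qed.

(** Every u has one peak set, and it lies in F_m, so the P_F are the indicators of the blocks of a
    partition. *)
Lemma inP_Peak x : inP x <-> exists g : {set 'I_m} -> rat, forall u, x u = g (Peak u).
Proof.
split=> [[d ->]|[g xg]]; first by exists d => u; rewrite PCE.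
by exists (finfun g); apply/ffunP => u; rewrite PCE ffunE.
Qed.

Lemma isF_sub F G : F \subset G -> isF G -> isF F.
Proof.
move=> /subsetP FG /isFP[G0 GG]; apply/isFP; split=> [i /FG/G0 //|i j /FG iG /FG].
exact: GG.
Qed.

Lemma isFO_PeakO u : isFO (PeakO u).
Proof.
apply/andP; split.
  by apply: isF_sub (isF_Peak u); apply/subsetP => i; rewrite inE => /andP[].
by apply/hasvP => -[i]; rewrite inE => /andP[_ /eqP].
Qed.

Lemma inPO_PeakO x : inPO x <-> exists g : {set 'I_m} -> rat, forall u, x u = g (PeakO u).
Proof.
have E (d : {set 'I_m} -> rat) u :
    (\sum_(F | isFO F) scl (d F) (PO F)) u = d (PeakO u).
  rewrite sum_sclE (bigD1 (PeakO u)) ?isFO_PeakO //= ffunE eqxx mulr1.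
  rewrite big1 ?addr0 // => F /andP[_ /negPf ne].
  by rewrite ffunE eq_sym ne mulr0.
split=> [[d ->]|[g xg]]; first by exists d => u; rewrite E.
by exists (finfun g); apply/ffunP => u; rewrite E ffunE.
Qed.

Lemma phi_sum (I : finType) (P : pred I) (c : I -> rat) (X : I -> QB m) u :
  phi (\sum_(i | P i) scl (c i) (X i)) u = \sum_(i | P i) c i * phi (X i) u.
Proof.
rewrite ffunE; under eq_bigr do rewrite sum_sclE.
rewrite exchange_big /=; apply: eq_bigr => i _.
by rewrite ffunE mulr_sumr.
Qed.

Lemma phiD (v w : QB m) : phi (v + w) = phi v + phi w.
Proof.
apply/ffunP => u; rewrite !ffunE -big_split /=.
by apply: eq_bigr => s _; rewrite ffunE.
Qed.

(** Elements count as i+1, so that even an extra element 0 makes a set strictly heavier. *)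
Definition weight F := (\sum_(i in F) i.+1)%N.
(** G ⊆ F ∪ (F-1), the condition for a peak set G to occur in φ(X_{F-1}). *)
Definition dominated G F := [forall g in G, hasv F g.+1 || (g \in F)].

(* Sending each g of G to g or g+1 in F is injective because G has no two consecutive elements. *)
Lemma dominated_weight F G : isF G -> dominated G F -> F = G \/ (weight G < weight F)%N.
Proof.
move=> /isFP[_ GG] /forall_inP dom.
(* For g in [G] outside [F], g+1 lies in [F], so the default of [insubd] is not reached. *)
pose h g := if g \in F then g else insubd g g.+1.
have hE g : g \in G -> (h g \in F) /\ (g \notin F -> h g = g.+1 :> nat).
  move=> gG; rewrite /h; case: ifP => // gF.
  have := dom g gG; rewrite gF orbF => /hasvP[i iF ie].
  have -> : insubd g g.+1 = i by apply/ord_inj; rewrite val_insubd -ie ltn_ord.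
  by [].
have hge g : g \in G -> (g <= h g)%N.
  move=> gG; have [_] := hE g gG; rewrite /h; case: ifP => // _ /(_ isT) ->.
  exact: leqnSn.
have hin g : g \in F -> h g = g by rewrite /h => ->.
have hinj : {in G &, injective h}.
  move=> g g' gG g'G e; have [_ h1] := hE g gG; have [_ h2] := hE g' g'G.
  case: (boolP (g \in F)) => gF; case: (boolP (g' \in F)) => g'F.
  - by rewrite -(hin g) // e hin.
  - by case: (GG g' g g'G gG); rewrite -h2 // -e hin.
  - by case: (GG g g' gG g'G); rewrite -h1 // e hin.
  - by apply/ord_inj/succn_inj; rewrite -h1 // -h2 // e.
have hGF : h @: G \subset F by apply/subsetP => _ /imsetP[g gG ->]; case: (hE g gG).
have wF : weight F = (\sum_(i in h @: G) i.+1 + \sum_(i in F :\: h @: G) i.+1)%N.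
  by rewrite /weight (big_setID (h @: G)) /= (setIidPr hGF).
have wh : (\sum_(i in h @: G) i.+1 = \sum_(g in G) (h g).+1)%N by rewrite big_imset.
(* Either some g in [G] moves up strictly, or [G] lies in [F] and any further element of [F] adds
   weight. *)
case: (boolP (G \subset F)) => GF; last first.
  right; case/subsetPn: GF => g gG gF.
  rewrite wF wh; apply: ltn_addr; rewrite /weight (bigD1 g) //= [ltnRHS](bigD1 g) //=.
  have [_ /(_ gF) ->] := hE g gG.
  by rewrite -addSn leq_add // leq_sum // => i /andP[iG _]; rewrite ltnS hge.
have [->|ne] := eqVneq F G; first by left.
right; have : G \proper F by rewrite properEneq eq_sym ne.
case/properP => _ [f fF fG].
rewrite [ltnRHS]/weight (big_setID G) /= (setIidPr GF) -addn1 leq_add2l.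
by rewrite (bigD1 f) //= inE fF fG.
Qed.

Definition down F : {set 'I_m} := [set j : 'I_m | hasv F j.+1].

Lemma mem_down_prev F (i : 'I_m) : (0 < i)%N -> (ord_prev i \in down F) = (i \in F).
Proof. by move=> i0; rewrite inE /= prednK // hasv_val. Qed.

(** For J = F-1, i ∈ J means i+1 ∈ F and i-1 ∈ J means i ∈ F; the latter uses i > 0, which [isF G]
    supplies. *)
Lemma compatB_down F G : isF G -> compatB (down F) G = dominated G F.
Proof.
move=> /isFP[G0 _]; apply: eq_forallb_in => g gG.
rewrite -[g.-1]/(val (ord_prev g)) hasv_val mem_down_prev ?G0 //.
by rewrite inE.
Qed.

Lemma dominated_refl F : dominated F F.
Proof. by apply/forall_inP => i ->; rewrite orbT. Qed.

Lemma dominated_solve (P : pred {set 'I_m}) (a : {set 'I_m} -> rat) (g : {set 'I_m} -> rat) :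
  (forall F, P F -> isF F) -> (forall F, a F != 0) ->
  exists c : {set 'I_m} -> rat, forall G, P G ->
    \sum_(F | P F) c F * (if dominated G F then a F else 0) = g G.
Proof.
move=> PF a0.
(* Outside [P] the matrix is completed by the identity, which keeps it triangular on all subsets. *)
pose M F G : rat := if P F && P G then if dominated G F then a F else 0
                    else (F == G)%:R.
have [||c cE] := @triangular_solve _ weight M _ _ g.
- by move=> F; rewrite /M eqxx dominated_refl; case: ifP => // _; apply: oner_neq0.
- move=> F G; rewrite /M; case: ifP => [/andP[_ PG]|_].
    by case: ifP; rewrite ?eqxx // => /(dominated_weight (PF _ PG)).
  by case: (F =P G) => [->|_]; [left | rewrite mulr0n eqxx].
exists c => G PG; rewrite -[RHS]cE big_mkcond; apply: eq_bigr => F _.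
rewrite /M PG andbT; case: ifP => // PF'.
by case: (F =P G) => [e|_]; [rewrite e PG in PF' | rewrite mulr0].
Qed.

Lemma phi_SigmaB (v : QB m) : inSigmaB v -> inP (phi v).
Proof.
case=> c ->; apply/inP_Peak; exists (fun F => \sum_J c J * nB J F) => u.
by rewrite phi_sum; apply: eq_bigr => J _; rewrite phi_XB.
Qed.

Lemma phi_SigmaB_surj x : inP x -> exists v : QB m, inSigmaB v /\ phi v = x.
Proof.
move=> /inP_Peak[g xg].
have [//|F|c cE] := @dominated_solve (@isF m) (fun F => 2 ^+ #|down F|) g.
  by rewrite expf_neq0.
exists (\sum_(F | isF F) scl (c F) (XB (down F))); split.
  exact: (@reindex_span _ _ _ _ predT).
apply/ffunP => u; rewrite phi_sum xg -cE ?isF_Peak //; apply: eq_bigr => F _.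
by rewrite phi_XB /nB compatB_down ?isF_Peak.
Qed.

(** With |w| = id, each edge is decided by the sign of its right-hand entry, and these signs are
    independent. *)
Lemma DesB_surj K : exists w : SP m, DesB w = K.
Proof.
pose s : {ffun 'I_m -> bool} := [ffun i => i \in K].
have d1 (i : 'I_m) : desc (1 : {perm 'I_m}) i = false.
  rewrite /desc uvS perm1; case: i => [[|j] ltj] //=.
  by have := uvS (1 : {perm 'I_m}) (Ordinal (ltnW ltj)); rewrite perm1 /= => ->; lia.
exists ((1%g, s) : SP m); apply/setP => i; apply: negb_inj.
by rewrite notin_DesB /top d1 ffunE; case: (i \in K).
Qed.

Lemma XBC_inj (c c' : {ffun {set 'I_m} -> rat}) :
  \sum_J scl (c J) (XB J) = \sum_J scl (c' J) (XB J) -> c = c'.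
Proof.
move=> e; apply: superset_sum_inj => K; have [w wK] := DesB_surj K.
have E (b : {ffun {set 'I_m} -> rat}) :
    \sum_(J : {set 'I_m} | K \subset J) b J = (\sum_J scl (b J) (XB J)) w.
  rewrite sum_sclE big_mkcond; apply: eq_bigr => J _.
  by rewrite ffunE wK; case: ifP; rewrite ?mulr1 ?mulr0.
by rewrite !E e.
Qed.

End PeakSpan.

Lemma setD1_notin (T : finType) (A : {set T}) x : x \notin A -> A :\ x = A.
Proof.
by move=> xA; apply/setP => i; rewrite !inE; case: eqP => // ->; rewrite (negPf xA).
Qed.

(** * Type D: prescriptions and the coefficients of ψ(X_J) *)

Section TypeD.
Variables (n : nat) (hn : (1 < n)%N).
Implicit Types (u : {perm 'I_n}) (s : {ffun 'I_n -> bool}) (F G J : {set 'I_n}).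
Implicit Types (K L : {set 'I_(n - 2)}) (c d : {ffun {set 'I_n} -> rat}).

Definition zero : 'I_n := Ordinal (ltnW hn).
Definition one : 'I_n := Ordinal hn.

(** Edge 1' (index 0) is an ascent iff w_1 + w_2 > 0, that is, iff the entry of larger absolute
    value is positive. It uses the same position as edge 1, always with bit [false]. *)
Definition topD u (i : 'I_n) := if i == 0%N :> nat then top u one else top u i.
Definition descD u (i : 'I_n) := (i != 0%N :> nat) && desc u i.

Lemma notin_DesD u s (i : 'I_n) :
  (i \notin DesD ((u, s) : SP n)) = (s (topD u i) == descD u i).
Proof.
rewrite /topD /descD; case: (posnP i) => [i0|ip]; last first.
  by rewrite /= -notin_DesB !inE gtn_eqF.
rewrite inE /= i0 eqxx /=.
have e1 := wvS ((u, s) : SP n) zero; have e2 := wvS ((u, s) : SP n) one.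
rewrite [X in _ < - X]e1 [X in X < _]e2 /= /top /desc.
have -> : uv u one.+1 = (u one).+1 by rewrite uvS.
have -> : uv u one = (u zero).+1 by rewrite -uvS.
have -> : ord_prev one = zero by apply/ord_inj.
have ne : (u one : nat) <> u zero by move/ord_inj/perm_inj/(congr1 val).
move: ne; case: ltnP => h ne /=.
  by case: (s zero); case: (s one); lia.
by case: (s zero); case: (s one); lia.
Qed.

Lemma DesD_sub u s J :
  (DesD ((u, s) : SP n) \subset J) = solves J (topD u) (descD u) s.
Proof.
apply/subsetP/forall_inP => [sub i|sol i].
  by rewrite inE => iJ; rewrite -notin_DesD; apply: contra iJ; apply: sub.
by apply: contraTT => iJ; rewrite notin_DesD sol // inE.
Qed.

(** At a peak 1, edge 1 clashes with 1'. At a peak 2, edge 2 clashes with both 1' and 1, which agree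
    with each other. Other peaks behave as in type B. *)
Definition compatD J F := [forall i in F, (i \in J) ||
  (if i == 1%N :> nat then hasv J 0
   else if i == 2%N :> nat then hasv J 0 && hasv J 1 else hasv J i.-1)].
Definition nD J F : rat :=
  if compatD J F then 2 ^+ #|J| / (if hasv J 0 || hasv J 1 then 2 else 1) else 0.

Lemma hasv0 J : hasv J 0 = (zero \in J). Proof. exact: (hasv_val J zero). Qed.
Lemma hasv1 J : hasv J 1 = (one \in J). Proof. exact: (hasv_val J one). Qed.

Lemma topD0 u : topD u zero = if desc u 1 then zero else one.
Proof. by rewrite /topD /top /=; case: ifP => // _; apply/ord_inj. Qed.

Lemma desc_gt0 u (i : 'I_n) : desc u i -> (0 < i)%N.
Proof. by case: (val i) => //; rewrite desc0. Qed.

Lemma consistentD u J : consistent J (topD u) (descD u) <-> compatD J (Peak u).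
Proof.
split=> [con|/forall_inP com].
  apply/forall_inP => i; rewrite mem_Peak => /andP[d' d].
  case: (boolP (i \in J)) => //= iJ.
  have i0 := desc_gt0 d.
  have tDi : topD u i = ord_prev i by rewrite /topD gtn_eqF // /top d.
  have dDi : descD u i by rewrite /descD -lt0n i0.
  have con' i' : topD u i' = ord_prev i -> ~~ descD u i' -> i' \in J.
    move=> e; apply: contraNT => i'J.
    by rewrite -(con i i') // tDi e.
  case: eqP => [i1|i1].
    rewrite hasv0; apply: con' => //; rewrite topD0 -i1 d.
    by apply/ord_inj; rewrite /= i1.
  case: eqP => [i2|i2].
    have p1 : ord_prev i = one by apply/ord_inj; rewrite /= i2.
    have d1 : desc u 1 = false by apply: negbTE; rewrite i2 in d'.
    rewrite hasv0 hasv1 !con' //.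
    - by rewrite p1 /topD /top /= d1.
    - by rewrite /descD /= d1.
    - by rewrite p1 topD0 d1.
  rewrite -[i.-1]/(val (ord_prev i)) hasv_val; apply: con'.
    by rewrite /topD /top /= (negPf d') -subn1 gtn_eqF //; lia.
  by rewrite /descD /= (negPf d') andbF.
suff con i i' : i \notin J -> i' \notin J -> topD u i = topD u i' ->
    descD u i -> descD u i'.
  by move=> i i' iJ i'J e; apply/idP/idP; apply: con.
move=> iJ i'J e /andP[i0 d]; apply/idPn.
rewrite /descD negb_and negbK => d'.
have ti : topD u i = ord_prev i by rewrite /topD (negPf i0) /top d.
move: e; rewrite ti => e.
have inP : ~~ desc u i.-1 -> i \in Peak u by rewrite mem_Peak d => ->.
(* If i' is the edge 1', the shared position i-1 is 0 or 1, so the peak is at 1 or 2. *)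
case: (posnP i') => [i'0|i'p].
  have {}i'0 : i' = zero by apply/ord_inj.
  move: e; rewrite i'0 topD0; case: ifP => d1 /(congr1 val) /= e.
    have i1 : (i : nat) = 1%N by move: i0; lia.
    have /inP/com : ~~ desc u i.-1 by rewrite i1 desc0.
    by rewrite (negPf iJ) i1 /= hasv0 -i'0 (negPf i'J).
  have i2 : (i : nat) = 2%N by move: i0; lia.
  have /inP/com : ~~ desc u i.-1 by rewrite i2 d1.
  by rewrite (negPf iJ) i2 /= hasv0 -i'0 (negPf i'J).
move: d'; rewrite gtn_eqF //= => d'.
move: e; rewrite /topD gtn_eqF // /top (negPf d') => e.
have ei : i.-1 = i' by rewrite -e.
have /inP/com : ~~ desc u i.-1 by rewrite ei.
rewrite (negPf iJ) ei hasv_val (negPf i'J) /=.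
case: eqP => [?|_]; first by lia.
case: eqP => [i2|//].
have -> : hasv J 1 = (i' \in J) by rewrite -hasv_val; congr hasv; lia.
by rewrite (negPf i'J) andbF.
Qed.

Lemma topD_inj u (i i' : 'I_n) : (0 < i)%N -> (0 < i')%N ->
  topD u i = topD u i' -> descD u i = descD u i' -> i = i'.
Proof.
move=> i0 i'0; rewrite /topD /descD -!lt0n i0 i'0 !gtn_eqF //; exact: top_inj.
Qed.

(** If 1' or 1 lies in J, [topD u] is injective off J. If neither does, these two edges share their
    position, which frees one more. *)
Lemma card_topD u J : compatD J (Peak u) ->
  #|~: (topD u @: (~: J))| = (#|J| + ~~ (hasv J 0 || hasv J 1))%N.
Proof.
move=> /consistentD con; apply/eqP; rewrite -(eqn_add2l #|topD u @: (~: J)|) cardsC.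
rewrite hasv0 hasv1; case: (boolP (_ || _)) => J01 /=.
  rewrite card_in_imset; first by rewrite addn0 addnC cardsC.
  (* [topD_inj] covers the positive edges. With equal bits, 1' can meet only edge 1, and one of
     these two is in [J]. *)
  suff inj (i i' : 'I_n) : i \notin J -> i' \notin J -> topD u i = topD u i' ->
      i = zero -> i' = zero.
    move=> i i'; rewrite !inE => iJ i'J e.
    case: (posnP i) => [i0|ip].
      have {}i0 : i = zero by apply/ord_inj.
      by rewrite i0 (inj i i').
    case: (posnP i') => [i0|i'p].
      have {}i0 : i' = zero by apply/ord_inj.
      by rewrite i0 (inj i' i).
    by apply: (topD_inj ip i'p e); apply: con.
  move=> iJ i'J e i0; have := con _ _ iJ i'J e.
  case: (posnP i') => [i'0|i'p]; first by move=> _; apply/ord_inj.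
  move: e; rewrite i0 topD0 /topD /top /descD -!lt0n i'p gtn_eqF //= => + d'.
  rewrite -d'; case: ifP => // _ e; exfalso.
  by move: J01; rewrite -i0 e (negPf iJ) (negPf i'J).
have {J01} [z1 o1] : zero \notin J /\ one \notin J by apply/andP; rewrite -negb_or.
have -> : topD u @: (~: J) = topD u @: ((~: J) :\ zero).
  apply/setP => k; apply/imsetP/imsetP => -[i iJ ->]; last first.
    by exists i => //; move: iJ; rewrite !inE => /andP[].
  case: (eqVneq i zero) => [->|ne]; last by exists i; rewrite ?inE ?ne //= -in_setC.
  by exists one; rewrite ?inE ?o1.
rewrite card_in_imset; last first.
  move=> i i'; rewrite !inE => /andP[iz iJ] /andP[i'z i'J] e.
  have nz (j : 'I_n) : j != zero -> (0 < j)%N.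
    by rewrite lt0n; apply: contraNneq => j0; apply/eqP/ord_inj.
  by apply: (topD_inj (nz _ iz) (nz _ i'z) e); apply: con.
by rewrite -(cardsC J) (cardsD1 zero (~: J)) !inE z1 addnCA addnC addnCA addnA.
Qed.

Lemma phi_XD J u : phi (XD J) u = nD J (Peak u).
Proof.
rewrite ffunE sum_same_perm.
under eq_bigr do rewrite ffunE DesD_sub andbC /inD /=.
rewrite sum_indicator /nD; case: ifP => [com|ncon].
  have con : consistent J (topD u) (descD u) by apply/consistentD.
  have cE := card_topD com.
  (* Halving by parity needs a free position: 1' or 1 in [J] gives one, and otherwise the extra
     position does. *)
  have C0 : (0 < #|~: (topD u @: (~: J))|)%N.
    rewrite cE; case: (boolP (_ || _)) => [|_]; last by rewrite addn1.
    rewrite addn0 hasv0 hasv1 => h; apply/card_gt0P.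
    by case/orP: h => h; [exists zero | exists one].
  have nT : topD u @: (~: J) != setT.
    by apply: contraTneq C0 => ->; rewrite setCT cards0.
  have := card_solves_even con nT; rewrite cE => /(congr1 (fun k => k%:R : rat)).
  rewrite natrM natrX; case: (_ || _) => /= e.
    by rewrite addn0 in e; rewrite -e mulrC mulKf.
  by move: e; rewrite addn1 exprS divr1 => /mulfI; apply.
rewrite (_ : [set s | _] = set0) ?cards0 //; apply/setP => s; rewrite !inE.
by apply/negP => /andP[/solves_consistent/consistentD]; rewrite ncon.
Qed.

(** * The shift of index sets by two, and γ *)

Lemma up_subproof (j : 'I_(n - 2)) : (j.+2 < n)%N.
Proof. by have := ltn_ord j; lia. Qed.

Definition up (j : 'I_(n - 2)) : 'I_n := Ordinal (up_subproof j).
Definition upset K := up @: K.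

Lemma up_inj : injective up.
Proof. by move=> i j /(congr1 val) [] /ord_inj. Qed.

Lemma upP (i : 'I_n) : (1 < i)%N -> exists j, i = up j.
Proof.
move=> i1; have i2 : (i - 2 < n - 2)%N by have := ltn_ord i; lia.
by exists (Ordinal i2); apply/ord_inj => /=; lia.
Qed.

Lemma hasv_upset K k : hasv (upset K) k.+2 = hasv K k.
Proof.
apply/hasvP/hasvP => [[_ /imsetP[j jK ->] [<-]]|[j jK <-]]; first by exists j.
by exists (up j); rewrite ?imset_f.
Qed.

Lemma hasv_upset0 K : hasv (upset K) 0 = false.
Proof. by apply/hasvP => -[_ /imsetP[j jK ->]]. Qed.

Lemma hasv_upset1 K : hasv (upset K) 1 = false.
Proof. by apply/hasvP => -[_ /imsetP[j jK ->]]. Qed.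

Lemma shift2_upset K : shift2 (upset K) = K.
Proof. by apply/setP => j; rewrite inE hasv_upset hasv_val. Qed.

Lemma upset_shift2 J : ~~ (hasv J 0 || hasv J 1) -> upset (shift2 J) = J.
Proof.
rewrite negb_or => /andP[J0 J1]; apply/setP => i; apply/imsetP/idP => [[j]|iJ].
  by rewrite inE -[(val j).+2]/(val (up j)) hasv_val => h ->.
have [j e] : exists j, i = up j.
  apply: upP; case: (ltngtP i 1) => // i1.
    by move: i1 J0; rewrite ltnS leqn0 => /eqP <-; rewrite hasv_val iJ.
  by move: J1; rewrite -i1 hasv_val iJ.
by exists j => //; rewrite inE -[(val j).+2]/(val (up j)) hasv_val -e.
Qed.

Lemma notin_upset1 K : one \notin upset K.
Proof. by rewrite -hasv1 hasv_upset1. Qed.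

(** The index sets avoiding 1' and 1 are exactly the K+2, and γ kills the others. *)
Lemma gammaCE c : gammaC c = \sum_K scl (c (upset K)) (XB K).
Proof.
apply/ffunP => w; rewrite !sum_sclE.
rewrite (bigID (fun J => hasv J 0 || hasv J 1)) /= big1 ?add0r; last first.
  by move=> J ->; rewrite ffunE mulr0.
rewrite (reindex_onto upset (@shift2 n)) => [|J]; last exact: upset_shift2.
rewrite (eq_bigl predT) => [|K]; last first.
  by rewrite hasv_upset0 hasv_upset1 shift2_upset eqxx.
by apply: eq_bigr => K _; rewrite hasv_upset0 hasv_upset1 shift2_upset.
Qed.

Lemma gammaC_eq0 c : gammaC c = 0 <-> forall K, c (upset K) = 0.
Proof.
rewrite gammaCE; split=> [e K|e]; last first.
  by apply/ffunP => w; rewrite sum_sclE ffunE big1 // => K _; rewrite e mul0r.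
have : [ffun K => c (upset K)] = [ffun=> 0].
  apply: XBC_inj; transitivity (0 : QB (n - 2)).
    by apply: etrans e; apply: eq_bigr => L _; rewrite ffunE.
  by apply/ffunP => w; rewrite sum_sclE big1 ?ffunE // => L _; rewrite ffunE mul0r.
by move/ffunP/(_ K); rewrite !ffunE.
Qed.

(** * Linear independence of the X_J in type D *)

Lemma even_signs (k0 : 'I_n) (t : 'I_n -> bool) :
  exists s : {ffun 'I_n -> bool},
    (forall k, k != k0 -> s k = t k) /\ ~~ odd #|[set k | s k]|.
Proof.
have k0T : ~: [set k0] != setT :> {set 'I_n}.
  by apply/negP => /eqP/setP/(_ k0); rewrite !inE eqxx.
have := card_forced_even t k0T; rewrite setCK cards1 => e.
have : (0 < #|[set s : {ffun 'I_n -> bool} | [forall k in ~: [set k0], s k == t k]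
             & ~~ odd #|[set k | s k]|]|)%N.
  by rewrite lt0n; apply/eqP => e0; rewrite e0 in e.
case/card_gt0P => s; rewrite inE => /andP[/forall_inP h ev]; exists s; split=> // k kk0.
by apply/eqP/h; rewrite !inE.
Qed.

(* When exactly one of 1' and 1 is a descent, |w_1| must exceed |w_2|;
   otherwise |w| = id works. In both cases one sign stays free to fix the
   parity. *)
Lemma DesD_surj J : exists w : SP n, inD w /\ DesD w = J.
Proof.
(* The larger of the first two entries gets sign bit [zero \in J], which settles 1'. Edge 1 is a
   descent iff this bit differs from [desc u 1], so [desc u 1] must equal [tw]. *)
pose tw := (zero \in J) != (one \in J).
pose u : {perm 'I_n} := if tw then tperm zero one else 1%g.
pose t (k : 'I_n) := if (k <= 1)%N then zero \in J else k \in J.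
have [s [sE ev]] := even_signs (if tw then one else zero) t.
have ge2 (i : 'I_n) : (1 < i)%N -> u i = i.
  move=> i1; rewrite /u; case: (tw); rewrite ?perm1 // tpermD //.
    by apply/negP => /eqP e; rewrite -e in i1.
  by apply/negP => /eqP e; rewrite -e in i1.
have d2 (i : 'I_n) : (1 < i)%N -> desc u i = false.
  move=> i1; rewrite /desc uvS ge2 //.
  have -> : uv u i = (u (ord_prev i)).+1 by rewrite -uvS /= prednK // ltnW.
  case: (ltnP 1 (ord_prev i)) => h; first by rewrite ge2 //=; lia.
  have e : ord_prev i = one by apply/ord_inj; move: h => /=; lia.
  by rewrite e /u; case: (tw); rewrite ?perm1 ?tpermR /=; lia.
have d1 : desc u 1 = tw.
  have e1 : uv u 2 = (u one).+1 by rewrite -uvS.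
  have e0 : uv u 1 = (u zero).+1 by rewrite -uvS.
  by rewrite /desc e1 e0 /u; case: (tw); rewrite ?perm1 ?tpermR ?tpermL.
exists ((u, s) : SP n); split=> //; apply/setP => i; apply: negb_inj.
rewrite notin_DesD /topD /descD.
have top1 : top u one = if tw then zero else one.
  by rewrite /top d1; case: (tw) => //; apply/ord_inj.
have s1 : s (if tw then zero else one) = (zero \in J) by rewrite sE; case: (tw).
case: (ltngtP i 1) => i1.
- have -> : i = zero by apply/ord_inj; move: i1 => /=; lia.
  by rewrite /= top1 s1; case: (_ \in _).
- rewrite !gtn_eqF 1?ltnW // /= d2 // /top d2 // sE /t.
    by rewrite leqNgt i1 /=; case: (_ \in _).
  by case: (tw); apply/negP => /eqP e; rewrite e in i1.
- have -> : i = one by apply/ord_inj.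
  rewrite /= top1 s1 [desc u _]d1 /tw.
  by case: (zero \in J); case: (one \in J).
Qed.

Lemma XDC_inj c c' : XDC c = XDC c' -> c = c'.
Proof.
move=> e; apply: superset_sum_inj => K; have [w [wD wK]] := DesD_surj K.
have E (b : {ffun {set 'I_n} -> rat}) : \sum_(J : {set 'I_n} | K \subset J) b J = XDC b w.
  rewrite sum_sclE big_mkcond; apply: eq_bigr => J _.
  by rewrite ffunE wK wD /=; case: ifP; rewrite ?mulr1 ?mulr0.
by rewrite !E e.
Qed.

(** By linear independence, membership in I can be read off the given coefficients. *)
Lemma inI_XDC c : inI (XDC c) <-> forall K, c (upset K) = 0.
Proof.
split=> [[b]|c0].
  rewrite restrict_span => /XDC_inj -> K.
  by rewrite ffunE hasv_upset0 hasv_upset1.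
exists c; rewrite restrict_span; congr XDC; apply/ffunP => J; rewrite ffunE.
by case: ifPn => // /upset_shift2 <-; rewrite c0.
Qed.

(** * The map π and its kernel *)

Lemma mem_shift2 F (j : 'I_(n - 2)) : (j \in shift2 F) = (up j \in F).
Proof. by rewrite inE -[(val j).+2]/(val (up j)) hasv_val. Qed.

(** Elements of K are at least 1, so those of K+2 are at least 3 and not adjacent to 1. *)
Lemma isF_one_upset K : isF K -> isF (one |: upset K).
Proof.
case/isFP => K0 KK; apply/isFP; split.
  by move=> i /setU1P[->|/imsetP[j _ ->]].
move=> i i' /setU1P[->|/imsetP[j jK ->]] /setU1P[->|/imsetP[j' j'K ->]] //= e.
  by case: e => e; have := K0 _ j'K; rewrite e.
by case: e => e; apply: (KK j j').
Qed.

Lemma isF_upset K : isF K -> isF (upset K).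
Proof. by move/isF_one_upset; apply: isF_sub; apply: subsetUr. Qed.

Lemma isF_shift2 F : isF F -> hasv F 1 || ~~ hasv F 2 -> isF (shift2 F).
Proof.
case/isFP => F0 FF F12; apply/isFP; split.
  move=> j; rewrite mem_shift2 lt0n => jF; apply/eqP => j0.
  have F2 : hasv F 2 by apply/hasvP; exists (up j) => //=; rewrite j0.
  move: F12; rewrite F2 orbF => /hasvP[i iF i1].
  by apply: (FF i (up j) iF jF) => /=; rewrite i1 j0.
move=> j j'; rewrite !mem_shift2 => jF j'F e; apply: (FF _ _ jF j'F).
by rewrite /= e.
Qed.

Lemma shift2_setD1 F : shift2 (F :\ one) = shift2 F.
Proof. by apply/setP => j; rewrite !mem_shift2 !inE. Qed.

Lemma setD_one F : [set i in F | val i != 1%N] = F :\ one.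
Proof. by apply/setP => i; rewrite !inE andbC. Qed.

Lemma upset_shift2_setD1 F : isF F -> upset (shift2 F) = F :\ one.
Proof.
case/isFP => F0 _; rewrite -shift2_setD1 upset_shift2 // hasv0 hasv1 !inE eqxx orbF.
by apply/negP => /andP[_ /F0].
Qed.

(** Exactly two sets of F_n contribute to P_G: G+2 with sign +, and {1} ∪ (G+2) with sign -. *)
Lemma piCE d (v : {perm 'I_(n - 2)}) :
  piC d v = d (upset (Peak v)) - d (one |: upset (Peak v)).
Proof.
have isP := isF_Peak v.
rewrite sum_sclE (bigID (fun F : {set 'I_n} => hasv F 1)) /= addrC; congr (_ + _).
  rewrite (bigD1 (upset (Peak v))) ?isF_upset ?hasv_upset1 //=.
  rewrite /piimg hasv_upset1 hasv_upset.
  case: ifP => [|_]; first by case/andP: isP => /negPf ->.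
  rewrite shift2_upset ffunE eqxx mulr1 big1 ?addr0 // => F /andP[/andP[isFF F1] ne].
  rewrite (negPf F1); case: ifP => _; first by rewrite ffunE mulr0.
  rewrite ffunE; case: eqP => [e|]; last by rewrite mulr0.
  by move: ne; rewrite e upset_shift2_setD1 // setD1_notin ?eqxx // -hasv1.
have one_in : hasv (one |: upset (Peak v)) 1 by rewrite hasv1 setU11.
rewrite (bigD1 (one |: upset (Peak v))) /=; last by rewrite isF_one_upset.
rewrite /piimg one_in setD_one setU1K ?notin_upset1 // shift2_upset.
rewrite !ffunE eqxx mulrN1 big1 ?addr0 // => F /andP[/andP[isFF F1] ne].
rewrite F1 setD_one shift2_setD1 !ffunE.
case: eqP => [e|]; last by rewrite oppr0 mulr0.
by move: ne; rewrite e upset_shift2_setD1 // setD1K ?eqxx // -hasv1.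
Qed.

Lemma PeakOE u : PeakO u = Peak u :\ one :> {set 'I_n}.
Proof. by rewrite -setD_one. Qed.

Lemma piC_eq0 d :
  piC d = 0 <-> forall K, isF K -> d (upset K) = d (one |: upset K).
Proof.
split=> [e K isK|e].
  have [v <-] := Peak_surj isK.
  by apply/eqP; rewrite -subr_eq0 -piCE e ffunE.
by apply/ffunP => v; rewrite piCE e ?isF_Peak // subrr ffunE.
Qed.

(** A set in F_n containing 1 avoids 2, hence is {1} ∪ (K+2). Equal coefficients at K+2 and {1} ∪
    (K+2) thus mean that the value at u depends only on Peak(u) without 1. *)
Lemma ker_pi d : piC d = 0 <-> inPO (PC d).
Proof.
rewrite piC_eq0 inPO_PeakO; split=> [e|[g gE] K isK].
  exists d => u; rewrite PCE PeakOE; have isP := isF_Peak u.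
  case: (boolP (hasv (Peak u) 1)) => P1.
    rewrite -upset_shift2_setD1 // e ?isF_shift2 ?P1 //.
    by rewrite upset_shift2_setD1 // setD1K // -hasv1.
  by rewrite setD1_notin // -hasv1.
have [u1 P1] := Peak_surj (isF_upset isK).
have [u2 P2] := Peak_surj (isF_one_upset isK).
rewrite -P2 -P1 -!PCE !gE !PeakOE P1 P2 setU1K ?notin_upset1 //.
by rewrite setD1_notin // notin_upset1.
Qed.

Lemma PC_eq d d' : PC d = PC d' -> forall F, isF F -> d F = d' F.
Proof. by move=> e F /Peak_surj[u <-]; rewrite -!PCE e. Qed.

Lemma piC_PC d d' : PC d = PC d' -> piC d = piC d'.
Proof.
move/PC_eq => e; apply/ffunP => v.
by rewrite !piCE !e ?isF_upset ?isF_one_upset ?isF_Peak.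
Qed.

(** * Commutativity of the square and surjectivity of ψ *)

Lemma nD_setD1 J F : hasv J 0 || hasv J 1 -> nD J (F :\ one) = nD J F.
Proof.
move=> J01; rewrite /nD; congr (if _ then _ else _).
(* Only the condition at 1 is affected, and it holds because 1' or 1 lies in [J]. *)
apply: eq_forallb => i; rewrite !inE.
case: eqP => [->|] //=.
by rewrite -(hasv1 J) orbC J01 implybT.
Qed.

Lemma nD_one J F : ~~ (hasv J 0 || hasv J 1) -> nD J (one |: F) = 0.
Proof.
rewrite negb_or => /andP[J0 J1]; rewrite /nD ifF //; apply/negbTE/forall_inP.
by move/(_ one); rewrite setU11 -hasv1 (negPf J0) (negPf J1) => /(_ isT).
Qed.

(** Elements of L+2 are at least 3, beyond the special cases 1 and 2 of [compatD]. *)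
Lemma nD_upset K L : isF L -> nD (upset K) (upset L) = nB K L.
Proof.
case/isFP => L0 _; rewrite /nD /nB hasv_upset0 hasv_upset1 divr1.
rewrite card_imset; last exact: up_inj.
congr (if _ then _ else _); apply/forall_inP/forall_inP => com.
  move=> j jL; have := com _ (imset_f up jL).
  rewrite mem_imset; last exact: up_inj.
  have := L0 j jL; rewrite /=; case: (val j) => // k _.
  by rewrite eqSS hasv_upset.
move=> _ /imsetP[j jL ->]; have := com j jL.
rewrite mem_imset; last exact: up_inj.
have := L0 j jL; rewrite /=; case: (val j) => // k _.
by rewrite eqSS hasv_upset.
Qed.

Lemma phi_XDC c u : phi (XDC c) u = \sum_J c J * nD J (Peak u).
Proof. by rewrite phi_sum; apply: eq_bigr => J _; rewrite phi_XD. Qed.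

(** π takes the difference of the values at G+2 and {1} ∪ (G+2). Terms with 1' or 1 in J cancel; for
    J = K+2 the second value is zero and the first is the type B coefficient of X_K. *)
Lemma pi_psi c d : PC d = phi (XDC c) -> piC d = phi (gammaC c).
Proof.
move=> e; have dE F : isF F -> d F = \sum_J c J * nD J F.
  by move=> /Peak_surj[u <-]; rewrite -PCE e phi_XDC.
apply/ffunP => v; have isP := isF_Peak v.
rewrite piCE !dE ?isF_upset ?isF_one_upset // -sumrB.
rewrite gammaCE phi_sum (bigID (fun J => hasv J 0 || hasv J 1)) /=.
rewrite big1 ?add0r => [|J J01]; last first.
  rewrite -(nD_setD1 (one |: _) J01) setU1K ?notin_upset1 // -mulrBr.
  by rewrite subrr mulr0.
rewrite (reindex_onto upset (@shift2 n)) => [|J]; last exact: upset_shift2.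
rewrite (eq_bigl predT) => [|K]; last first.
  by rewrite hasv_upset0 hasv_upset1 shift2_upset eqxx.
apply: eq_bigr => K _; rewrite nD_one ?hasv_upset0 ?hasv_upset1 // mulr0 subr0.
by rewrite nD_upset // phi_XB.
Qed.

Lemma phi_SigmaD (v : QB n) : inSigmaD v -> inP (phi v).
Proof.
case=> c ->; apply/inP_Peak; exists (fun F => \sum_J c J * nD J F) => u.
exact: phi_XDC.
Qed.

Lemma phi_I (v : QB n) : inI v -> inPO (phi v).
Proof.
case=> c ->; apply/inPO_PeakO.
exists (fun F => \sum_(J | hasv J 0 || hasv J 1) c J * nD J F) => u.
rewrite phi_sum; apply: eq_bigr => J J01.
by rewrite phi_XD PeakOE nD_setD1.
Qed.

(** Adjoining 1' to F-1 puts X_J in I. Since 1 ∉ G, it matters only at 2, where the condition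
    becomes 1 ∈ J, that is, 2 ∈ F. *)
Lemma compatD_down F G : isFO F -> isFO G ->
  compatD (zero |: down F) G = dominated G F.
Proof.
move=> /andP[isFF F1] /andP[isFG G1]; apply: eq_forallb_in => g gG.
have [G0 _] := isFP _ isFG.
have g0 := G0 g gG.
have g1 : (g : nat) != 1%N.
  by apply: contraNneq G1 => <-; rewrite hasv_val.
have nz : g != zero by apply/eqP => e; rewrite e in g0.
have -> : (g \in zero |: down F) = hasv F g.+1 by rewrite in_setU1 (negPf nz) inE.
rewrite (negPf g1) hasv0 hasv1 setU11 /=; congr (_ || _).
case: eqP => [g2|g2].
  have e : one = ord_prev g by apply/ord_inj; rewrite /= g2.
  by rewrite e in_setU1 mem_down_prev // -e.
rewrite -[g.-1]/(val (ord_prev g)) hasv_val in_setU1 mem_down_prev //.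
case: eqP => //= /(congr1 val) /= e.
by move: g0 g1 e; case: (nat_of_ord g) => [|[]].
Qed.

Lemma phi_I_surj (x : QS n) : inPO x -> exists v : QB n, inI v /\ phi v = x.
Proof.
move=> /inPO_PeakO[g xg].
pose J F := zero |: down F.
have J0 F : hasv (J F) 0 || hasv (J F) 1 by rewrite hasv0 setU11.
have [F /andP[] //|F|c cE] :=
  @dominated_solve n (@isFO n) (fun F => 2 ^+ #|J F| / 2) g.
  by rewrite mulf_neq0 // expf_neq0.
exists (\sum_(F | isFO F) scl (c F) (XD (J F))); split.
  by apply: (@reindex_span _ _ _ _ (fun L : {set 'I_n} => hasv L 0 || hasv L 1)) => F _.
apply/ffunP => u; rewrite phi_sum xg -cE ?isFO_PeakO //; apply: eq_bigr => F isFF.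
rewrite phi_XD -nD_setD1 // -PeakOE.
by rewrite /nD J0 compatD_down // isFO_PeakO.
Qed.

Lemma inI_SigmaD (v : QB n) : inI v -> inSigmaD v.
Proof. by case=> c ->; rewrite restrict_span; eexists. Qed.

Lemma gammaC_surj (v : QB (n - 2)) : inSigmaB v <-> exists c, gammaC c = v.
Proof.
split=> [[c ->]|[c <-]].
  exists [ffun J : {set 'I_n} => c (shift2 J)]; rewrite gammaCE.
  by apply: eq_bigr => K _; rewrite ffunE shift2_upset.
exists [ffun K => c (upset K)]; rewrite gammaCE.
by apply: eq_bigr => K _; rewrite ffunE.
Qed.

Lemma piC_surj (x : QS (n - 2)) : inP x <-> exists d, piC d = x.
Proof.
rewrite inP_Peak; split=> [[g xg]|[d <-]].
  exists [ffun F : {set 'I_n} => if one \in F then 0 else g (shift2 F)]; apply/ffunP => v.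
  by rewrite piCE !ffunE setU11 (negPf (notin_upset1 _)) shift2_upset subr0 xg.
by exists (fun K => d (upset K) - d (one |: upset K)) => v; rewrite piCE.
Qed.

(* The five-lemma chase: correct a lift through gamma by an element of I. *)
Lemma phi_SigmaD_surj (x : QS n) : inP x -> exists v : QB n, inSigmaD v /\ phi v = x.
Proof.
case=> d ->.
have /phi_SigmaB_surj[w [/gammaC_surj[c <-] cE]] : inP (piC d).
  by apply/piC_surj; exists d.
have [d' d'E] : inP (phi (XDC c)) by apply: phi_SigmaD; exists c.
have pi_d' : piC d' = piC d by rewrite (pi_psi (esym d'E)).
pose e : {ffun {set 'I_n} -> rat} := d - d'.
have /ker_pi/phi_I_surj[v [/inI_SigmaD[b vb] vE]] : piC e = 0.
  apply/ffunP => u; have := congr1 (fun f : QS (n - 2) => f u) pi_d'.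
  rewrite !piCE !ffunE => h.
  by rewrite opprD addrACA -opprD h subrr.
exists (XDC c + v); split.
  exists (c + b); rewrite vb; apply/ffunP => s.
  rewrite ffunE !sum_sclE -big_split /=; apply: eq_bigr => J _.
  by rewrite [(c + b) J]ffunE mulrDl.
apply/ffunP => u; rewrite phiD vE d'E [LHS]ffunE !PCE !ffunE.
by rewrite addrC subrK.
Qed.

End TypeD.

(** γ and π act on coefficient families, so each sequence first records that the result depends only
    on the vector represented; commutativity then ranges over all [d] representing ψ([XDC c]). *)
Theorem theorem5p12 (n : nat) (hn : (2 <= n)%N) :
  (* first sequence: gamma well defined, I ⊆ Σ(D_n), ker gamma = I, gamma onto Σ(B_{n-2}) *)
  [/\ (forall c c' : {ffun {set 'I_n} -> rat}, XDC c = XDC c' -> gammaC c = gammaC c'),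
      (forall v : QB n, inI v -> inSigmaD v),
      (forall c : {ffun {set 'I_n} -> rat}, gammaC c = 0 <-> inI (XDC c))
    & (forall v : QB (n - 2), inSigmaB v <-> exists c : {ffun {set 'I_n} -> rat}, gammaC c = v)
  ] /\
  (* second sequence: pi well defined, P° ⊆ P_n, ker pi = P°, pi onto P_{n-2} *)
  [/\ (forall d d' : {ffun {set 'I_n} -> rat}, PC d = PC d' -> piC d = piC d'),
      (forall x : QS n, inPO x -> inP x),
      (forall d : {ffun {set 'I_n} -> rat}, piC d = 0 <-> inPO (PC d))
    & (forall x : QS (n - 2), inP x <-> exists d : {ffun {set 'I_n} -> rat}, piC d = x)
  ] /\
  (* psi, phi well defined and surjective *)
  [/\ (forall v : QB n, inI v -> inPO (phi v)) /\
        (forall x : QS n, inPO x -> exists v : QB n, inI v /\ phi v = x),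
      (forall v : QB n, inSigmaD v -> inP (phi v)) /\
        (forall x : QS n, inP x -> exists v : QB n, inSigmaD v /\ phi v = x)
    & (forall v : QB (n - 2), inSigmaB v -> inP (phi v)) /\
        (forall x : QS (n - 2), inP x -> exists v : QB (n - 2), inSigmaB v /\ phi v = x)
  ] /\
  (* commutativity: pi o psi = phi o gamma on Σ(D_n) *)
  (forall c d : {ffun {set 'I_n} -> rat}, PC d = phi (XDC c) -> piC d = phi (gammaC c)).
Proof.
split; [|split; [|split]].
- split.
  + by move=> c c' /(XDC_inj hn) ->.
  + exact: inI_SigmaD.
  + by move=> c; rewrite (gammaC_eq0 hn) (inI_XDC hn).
  + exact: gammaC_surj.
- split.
  + exact: piC_PC.
  + move=> x /inPO_PeakO[g xg]; apply/inP_Peak.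
    by exists (fun F : {set 'I_n} => g [set i in F | val i != 1%N]).
  + exact: ker_pi.
  + exact: piC_surj.
- split; split.
  + exact: phi_I.
  + exact: phi_I_surj.
  + exact: phi_SigmaD.
  + exact: phi_SigmaD_surj.
  + exact: phi_SigmaB.
  + exact: phi_SigmaB_surj.
- exact: pi_psi.
Qed.
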